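(* Let $\alpha\in\mathbb{R}\setminus\pi\mathbb{Z}$. If $f\in e_{-\alpha}L^1(\mathbf{T}^1_\alpha)$ has both left and right limits at a point $x_0$, denoted by $f(x_{0-})$ and $f(x_{0+})$, respectively, then $$(f\overset{\alpha}{\ast}F^1_N)(x_0)\to\frac12\big(f(x_{0+})+f(x_{0-})\big)\quad\text{as }N\to\infty.$$
   Context: Let $\alpha\in\mathbb{R}\setminus\pi\mathbb{Z}$. The fractional torus $\mathbf{T}^1_\alpha$ is the interval of length $|\sin\alpha|$ with endpoints identified, represented by $[-|\sin\alpha|/2,|\sin\alpha|/2]$; functions on $\mathbf{T}^1_\alpha$ are $|\sin\alpha|$-periodic functions on $\mathbb{R}$, equivalently functions on this interval, and integrals over $\mathbf{T}^1_\alpha$ are taken over this interval. Put $e_\alpha(x)=e^{\pi i x^2\cot\alpha}$, $e_{-\alpha}(x)=e^{-\pi i x^2\cot\alpha}$. $e_{-\alpha}L^1(\mathbf{T}^1_\alpha)$ is the space of functions $f=e_{-\alpha}g$ on the interval with $g\in L^1(\mathbf{T}^1_\alpha)$; for such $f$, $e_\alpha f$ denotes the periodic function $g$. For $f\in e_{-\alpha}L^1(\mathbf{T}^1_\alpha)$ and a $1$-periodic integrable $g$, the fractional convolution is $$(f\overset{\alpha}{\ast}g)(x)=|\csc\alpha|\,e_{-\alpha}(x)\int_{\mathbf{T}^1_\alpha}e_\alpha(y)f(y)\,g\big((x-y)\csc\alpha\big)\,dy .$$ $F^1_N(t)=\sum_{j=-N}^N\big(1-\frac{|j|}{N+1}\big)e^{2\pi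 i jt}$ is the classical Fejér kernel. *)

(* Defs.v *)
From HB Require Import structures.
From mathcomp Require Import all_boot all_order all_algebra.
From mathcomp Require Import all_classical all_reals all_analysis.
From mathcomp Require Import complex.

Set Implicit Arguments.
Unset Strict Implicit.
Unset Printing Implicit Defensive.

Import Order.TTheory GRing.Theory Num.Theory.
Import numFieldNormedType.Exports.

Local Open Scope classical_set_scope.
Local Open Scope ring_scope.
Local Open Scope complex_scope.

(* The usual topology of the complex numbers, given by the modulus: MathComp
   real-closed does not equip [R[i]] with it. *)
HB.instance Definition _ (R : realType) := PseudoMetricNormedZmod.copy R[i] R[i]^o.

Section FractionalTorus.
Context {R : realType}.
Implicit Types (alpha x t : R) (f g : R -> R[i]).

Definition cot alpha : R := cos alpha / sin alpha.
Definition csc alpha : R := (sin alpha)^-1.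

(* e^{it} for real t *)
Definition cexpi t : R[i] := (cos t +i* sin t)%C.

(* e_alpha(x) = e^{pi i x^2 cot alpha} *)
Definition chirp alpha x : R[i] := cexpi (pi * x ^+ 2 * cot alpha).

(* e_{-alpha}(x) = e^{- pi i x^2 cot alpha} *)
Definition chirpN alpha x : R[i] := cexpi (- (pi * x ^+ 2 * cot alpha)).

Definition torus alpha : set R :=
  `[- (`|sin alpha| / 2), `|sin alpha| / 2]%classic.

Definition cintegrable (D : set R) f : Prop :=
  lebesgue_measure.-integrable D (fun x => (complex.Re (f x))%:E) /\
  lebesgue_measure.-integrable D (fun x => (complex.Im (f x))%:E).

Definition cintegral (D : set R) f : R[i] :=
  ((\int[lebesgue_measure]_(x in D) complex.Re (f x)) +i*
   (\int[lebesgue_measure]_(x in D) complex.Im (f x)))%C.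

Definition L1_torus alpha g : Prop :=
  periodic g `|sin alpha| /\ cintegrable (torus alpha) g.

(* A function on the torus is a |sin alpha|-periodic function on R. The chirp
   is not periodic, so f = e_{-alpha} g is only required on the fundamental
   interval; this is consistent at the two identified endpoints because the
   chirp is even. *)
Definition chirpN_L1_torus alpha f : Prop :=
  periodic f `|sin alpha| /\
  exists2 g, L1_torus alpha g &
    forall x, torus alpha x -> f x = chirpN alpha x * g x.

(* To be used at points x of [torus alpha], as the chirp is not periodized. *)
Definition frac_conv alpha f g x : R[i] :=
  `|csc alpha|%:C * chirpN alpha x *
  cintegral (torus alpha)
    (fun y => chirp alpha y * f y * g ((x - y) * csc alpha)).

(* The index k stands for j = k - N, which ranges over -N, ..., N. *)
Definition fejer (N : nat) t : R[i] :=
  \sum_(0 <= k < N.*2.+1)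
    let j : int := k%:Z - N%:Z in
    (1 - `|j|%:~R / N.+1%:R)%:C * cexpi (2 * pi * j%:~R * t).

End FractionalTorus.

(* Main.v *)
Require Import Defs.
From HB Require Import structures.
From mathcomp Require Import all_boot all_order all_algebra.
From mathcomp Require Import all_classical all_reals all_analysis.
From mathcomp Require Import measurable_realfun.
From mathcomp Require Import complex.
From mathcomp Require Import zify ring lra.

Import Order.TTheory GRing.Theory Num.Theory.
Import numFieldNormedType.Exports.

Local Open Scope classical_set_scope.
Local Open Scope ring_scope.
Local Open Scope complex_scope.

(** Put s = |sin alpha|. On the fundamental interval f = e_{-alpha} g with g
    periodic of period s, so that the two chirps under the integral cancel and

      (f * F_N)(x0) = s^-1 e_{-alpha}(x0) \int g(y) F_N((y - x0) / s) dy,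

    the integral being over one period; the sign of csc alpha disappears because
    F_N is even ([frac_conv_fejer]). The theorem thus reduces to the classical
    Fejer theorem at a jump for the real and imaginary parts of g
    ([fejer_mean_cvg]), together with the fact that the one-sided limits of g at
    x0 are e_alpha(x0) times those of f ([cvg_left_dechirp],
    [cvg_right_dechirp]).

    For the classical theorem, the integral of a periodic function over a period
    does not depend on where the period starts ([periodic_Rintegral], a
    consequence of the translation invariance of Lebesgue measure), so the period
    may be centred at x0 and cut there. On each half, the kernel
    F_N((y - x0) / s) is nonnegative because it is a sum of two squares
    ([fejerR_sqr]), has integral s / 2 by an explicit primitive, and tends to 0
    uniformly away from x0 because (N + 1) sin(pi t)^2 F_N(t) =
    sin((N + 1) pi t)^2 ([fejerR_sin]). An approximate identity of mass s / 2
    ([approximate_identity]) therefore multiplies each one-sided limit by s / 2. *)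

(** * The Fejer kernel *)

Lemma sum_centered (V : nmodType) (F : int -> V) (N : nat) :
  \sum_(0 <= k < N.*2.+1) F (k%:Z - N%:Z) =
  F 0 + \sum_(j < N) (F j.+1%:Z + F (- j.+1%:Z)).
Proof.
elim: N => [|N IHN]; first by rewrite big_nat1 big_ord0 [RHS]addr0.
rewrite doubleS big_nat_recl// big_nat_recr//= big_ord_recr/= [RHS]addrA -IHN.
rewrite addrC -addrA; congr (_ + _).
  by apply: eq_bigr => k _; congr F; lia.
by congr (F _ + F _); lia.
Qed.

Section FejerKernel.
Context {R : realType}.
Implicit Types (N : nat) (t x : R).

(** The cosine form of the kernel, obtained by pairing the frequencies j and -j. *)
Definition fejerR N t : R :=
  1 + \sum_(j < N) (1 - j.+1%:R / N.+1%:R) * (cos (2 * pi * j.+1%:R * t) *+ 2).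

Lemma fejerE N t : fejer N t = (fejerR N t)%:C.
Proof.
rewrite /fejer (sum_centered _ (fun j : int =>
  (1 - `|j|%:~R / N.+1%:R)%:C * cexpi (2 * pi * j%:~R * t))).
rewrite /fejerR [RHS]rmorphD [in RHS]rmorph_sum/=; congr (_ + _).
  by rewrite normr0 mul0r subr0 mul1r mulr0 mul0r /cexpi cos0 sin0.
apply: eq_bigr => j _.
rewrite normrN ger0_norm// -mulrDr [RHS]rmorphM; congr (_ * _).
rewrite /cexpi mulrNz mulrN mulNr cosN sinN.
by apply/eqP; rewrite eq_complex/= subrr !eqxx.
Qed.

Lemma fejerRN N t : fejerR N (- t) = fejerR N t.
Proof. by congr (_ + _); apply: eq_bigr => j _; rewrite mulrN cosN. Qed.

Let csum n x : R := \sum_(k < n.+1) cos (k%:R * (x *+ 2)).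
Let ssum n x : R := \sum_(k < n.+1) sin (k%:R * (x *+ 2)).

(** With x = pi t, the right-hand side is the squared modulus of the geometric
    sum of e^{2 i k x} over 0 <= k <= N. Passing from N to N + 1 adds
    1 + 2 \sum_{1 <= j <= N+1} cos(2 j x) to both sides. The square shows
    that the kernel is nonnegative without a case distinction at the zeros of
    sin x. *)
Lemma fejerR_sqr N t :
  N.+1%:R * fejerR N t = csum N (pi * t) ^+ 2 + ssum N (pi * t) ^+ 2.
Proof.
set x := pi * t.
have -> : N.+1%:R * fejerR N t = N.+1%:R + \sum_(j < N)
    (N.+1%:R - j.+1%:R) * (cos (j.+1%:R * (x *+ 2)) *+ 2).
  rewrite mulrDr mulr1 mulr_sumr; congr (_ + _); apply: eq_bigr => j _.
  rewrite mulrA mulrBr mulr1 mulrCA divff ?pnatr_eq0// mulr1.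
  by congr (_ * (cos _ *+ 2)); rewrite /x; ring.
elim: N => [|N IHN].
  by rewrite /csum /ssum !big_ord1 big_ord0 mul0r cos0 sin0; ring.
rewrite /csum /ssum (big_ord_recr N.+1)/= [in RHS](big_ord_recr N.+1)/=.
rewrite -/(csum N x) -/(ssum N x).
have -> : \sum_(j < N.+1) (N.+2%:R - j.+1%:R) * (cos (j.+1%:R * (x *+ 2)) *+ 2)
  = \sum_(j < N) (N.+1%:R - j.+1%:R) * (cos (j.+1%:R * (x *+ 2)) *+ 2)
    + \sum_(j < N.+1) cos (j.+1%:R * (x *+ 2)) *+ 2.
  rewrite !big_ord_recr/= addrA -big_split/=; congr (_ + _).
    by apply: eq_bigr => j _; rewrite -(natr1 N.+1); ring.
  by rewrite -(natr1 N.+1); ring.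
(* The cross terms of the two squares form a Dirichlet sum read backwards,
   by the subtraction formula for the cosine. *)
have -> : \sum_(j < N.+1) cos (j.+1%:R * (x *+ 2)) *+ 2 =
    (csum N x * cos (N.+1%:R * (x *+ 2)) +
     ssum N x * sin (N.+1%:R * (x *+ 2))) *+ 2.
  rewrite /csum /ssum !mulr_suml -big_split/= -sumrMnl.
  rewrite (reindex_inj rev_ord_inj)/=; apply: eq_bigr => k _.
  rewrite [X in _ = X *+ 2]addrC addrC -cosB -cosN; congr (cos _ *+ 2).
  have kN : (k <= N)%N by rewrite -ltnS.
  rewrite subSS -natr1 natrB// -(natr1 N); ring.
rewrite -(natr1 N.+1).
have := cos2Dsin2 (N.+1%:R * (x *+ 2)).
move: IHN; lra.
Qed.

Lemma fejerR_ge0 N t : 0 <= fejerR N t.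
Proof.
by rewrite -(pmulr_rge0 _ (ltr0Sn R N)) fejerR_sqr addr_ge0// sqr_ge0.
Qed.

(** This and [sin_ssum] are the real and imaginary parts of the closed form
    of a geometric sum. *)
Lemma sin_csum n x : sin x * csum n x = sin (n.+1%:R * x) * cos (n%:R * x).
Proof.
elim: n => [|n IHn]; first by rewrite /csum big_ord1 !mul0r mul1r cos0.
rewrite /csum big_ord_recr/= mulrDr -/(csum n x) IHn.
set a := n.+1%:R * x.
have -> : n%:R * x = a - x by rewrite /a -(natr1 n); ring.
have -> : n.+2%:R * x = a + x by rewrite /a -(natr1 n.+1); ring.
have -> : n.+1%:R * (x *+ 2) = a *+ 2 by rewrite /a; ring.
rewrite cosB sinD cos_mulr2n.
apply/eqP; rewrite -subr_eq0; apply/eqP.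
transitivity (sin x * (sin a ^+ 2 - (1 - cos a ^+ 2))); first by ring.
by rewrite -sin2cos2 subrr mulr0.
Qed.

Lemma sin_ssum n x : sin x * ssum n x = sin (n.+1%:R * x) * sin (n%:R * x).
Proof.
elim: n => [|n IHn]; first by rewrite /ssum big_ord1 !mul0r mul1r sin0 !mulr0.
rewrite /ssum big_ord_recr/= mulrDr -/(ssum n x) IHn.
set a := n.+1%:R * x.
have -> : n%:R * x = a - x by rewrite /a -(natr1 n); ring.
have -> : n.+2%:R * x = a + x by rewrite /a -(natr1 n.+1); ring.
have -> : n.+1%:R * (x *+ 2) = a *+ 2 by rewrite /a; ring.
rewrite sin_mulr2n sinB sinD; ring.
Qed.

Lemma fejerR_sin N t :
  N.+1%:R * fejerR N t * sin (pi * t) ^+ 2 = sin (N.+1%:R * (pi * t)) ^+ 2.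
Proof.
rewrite fejerR_sqr mulrC mulrDr -!exprMn sin_csum sin_ssum !exprMn.
by rewrite -mulrDr cos2Dsin2 mulr1.
Qed.

(** The uniform decay of the kernel away from 0: the sine is increasing on
    the interval from 0 to pi / 2, so |sin (pi t)| is at least sin (pi eta). *)
Lemma fejerR_le N (eta t : R) : 0 < eta -> eta <= `|t| <= 2^-1 ->
  fejerR N t <= (sin (pi * eta) ^+ 2)^-1 * N.+1%:R^-1.
Proof.
move=> eta0 /andP[etat t2].
wlog t0 : t etat t2 / 0 <= t.
  move=> H; have [/H->//|/ltW t0] := leP 0 t.
  by rewrite -fejerRN; apply: H; rewrite ?normrN ?oppr_ge0.
rewrite ger0_norm// in etat t2.
have pi0 := pi_gt0 R.
have s0 : 0 < sin (pi * eta).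
  by rewrite sin_gt0_pi// mulr_gt0//=; nra.
have sle : sin (pi * eta) <= sin (pi * t).
  rewrite le_eqVlt; move: etat; rewrite le_eqVlt => /predU1P[->|etat].
    by rewrite eqxx.
  by rewrite ltr_sin ?orbT ?in_itv//=; [apply/orP; right; nra|nra..].
rewrite -invfM -div1r ler_pdivlMr ?mulr_gt0 ?exprn_gt0//.
apply: (@le_trans _ _ (N.+1%:R * fejerR N t * sin (pi * t) ^+ 2)).
  rewrite [leLHS](_ : _ = N.+1%:R * fejerR N t * sin (pi * eta) ^+ 2).
    rewrite ler_wpM2l ?mulr_ge0 ?fejerR_ge0//.
    by rewrite lerXn2r ?nnegrE// ltW// (lt_le_trans s0).
  by ring.
rewrite fejerR_sin -(expr1n _ 2) -[X in X <= _]real_normK ?num_real//.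
by rewrite lerXn2r ?nnegrE ?sin_max.
Qed.

Lemma fejerR_bounded N : exists M, forall t, `|fejerR N t| <= M.
Proof.
exists (1 + \sum_(j < N) `|1 - j.+1%:R / N.+1%:R| * (1 *+ 2)) => t.
rewrite (le_trans (ler_normD _ _))// normr1 lerD2l.
rewrite (le_trans (ler_norm_sum _ _ _))//; apply: ler_sum => j _.
by rewrite normrM normrMn ler_wpM2l// lerMn2r cos_max.
Qed.

(** The odd primitive of the kernel; its value at 1/2 does not depend on N
    since sin (pi j) = 0. *)
Definition fejer_primitive N t : R :=
  t + \sum_(j < N) (1 - j.+1%:R / N.+1%:R) / (pi * j.+1%:R)
                   * sin (2 * pi * j.+1%:R * t).

Lemma is_derive_fejer_primitive N t : is_derive t 1 (fejer_primitive N) (fejerR N t).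
Proof.
have -> : fejer_primitive N = id + \sum_(j < N)
    (fun u => (1 - j.+1%:R / N.+1%:R) / (pi * j.+1%:R)
              * sin (2 * pi * j.+1%:R * u)).
  by apply/funext => u; rewrite /fejer_primitive fctE/= fct_sumE.
apply: is_deriveD; apply: is_derive_sum => j.
apply: is_derive_eq.
rewrite /GRing.scale/=.
have j0 : j.+1%:R != 0 :> R by rewrite pnatr_eq0.
have N0 : N.+1%:R != 0 :> R by rewrite pnatr_eq0.
have pi0 : pi != 0 :> R by rewrite gt_eqF ?pi_gt0.
move: (pi : R) pi0 => P P0.
by field; rewrite !nat1r j0 N0 P0.
Qed.

Lemma continuous_fejerR N : continuous (fejerR N).
Proof.
move=> t; apply: differentiable_continuous; apply/derivable1_diffP.
rewrite (_ : fejerR N = cst 1 + \sum_(j < N)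
  (fun u => (1 - j.+1%:R / N.+1%:R) * (2 * cos (2 * pi * j.+1%:R * u)))).
  by apply: derivableD.
apply/funext => u; rewrite fctE/= fct_sumE; congr (_ + _).
by apply: eq_bigr => j _; rewrite [2 * cos _]mulr_natl.
Qed.

Lemma sin_pi_nat n : sin (pi * n%:R) = 0 :> R.
Proof.
elim: n => [|n IHn]; first by rewrite mulr0 sin0.
by rewrite -natr1 mulrDr mulr1 sinDpi IHn oppr0.
Qed.

Lemma fejer_primitive0 N : fejer_primitive N 0 = 0.
Proof.
by rewrite /fejer_primitive big1 ?addr0// => j _; rewrite mulr0 sin0 mulr0.
Qed.

Lemma fejer_primitiveN N t : fejer_primitive N (- t) = - fejer_primitive N t.
Proof.
rewrite /fejer_primitive opprD -sumrN; congr (_ + _); apply: eq_bigr => j _.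
by rewrite mulrN sinN mulrN.
Qed.

Lemma fejer_primitive_half N : fejer_primitive N 2^-1 = 2^-1.
Proof.
rewrite /fejer_primitive big1 ?addr0// => j _.
rewrite (_ : 2 * pi * _ * _ = pi * j.+1%:R) ?sin_pi_nat ?mulr0//.
by field.
Qed.

Lemma integral_fejerR N (x0 s a b : R) : 0 < s -> a < b ->
  \int[lebesgue_measure]_(y in `[a, b]) fejerR N ((y - x0) / s) =
  s * (fejer_primitive N ((b - x0) / s) - fejer_primitive N ((a - x0) / s)).
Proof.
move=> s0 ab; pose Q (y : R) : R := s * fejer_primitive N ((y - x0) / s).
have dQ (y : R) : is_derive y (1 : R) Q (fejerR N ((y - x0) / s)).
  have H := is_derive_fejer_primitive N ((y - x0) / s).
  have H1 : is_derive y (1 : R) (fun z : R => (z - x0) / s) s^-1.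
    by apply: is_derive_eq; rewrite /GRing.scale/=; ring.
  have H2 := is_deriveZ s
    (@is_derive1_comp _ (fejer_primitive N) (fun z => (z - x0) / s) y _ _ H H1).
  apply: (@is_derive_eq _ _ _ Q y _ _ _ H2); rewrite /GRing.scale/=.
  by rewrite mulrCA mulfV ?gt_eqF// mulr1.
have cQ : continuous Q.
  move=> y; apply: differentiable_continuous; apply/derivable1_diffP.
  by apply: ex_derive.
rewrite /Rintegral (@continuous_FTC2 _ _ Q)//; first by rewrite /= -mulrBr.
- apply: continuous_subspaceT => y.
  apply: (@continuous_comp _ _ _ (fun z => (z - x0) / s) (fejerR N)).
    by apply: differentiable_continuous; apply/derivable1_diffP.
  exact: continuous_fejerR.
- split; first by move=> y _; apply: ex_derive.
  + exact/cvg_at_right_filter/cQ.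
  + exact/cvg_at_left_filter/cQ.
- by move=> y _; rewrite derive1E derive_val.
Qed.

Lemma integral_fejerR_right N (x0 s : R) : 0 < s ->
  \int[lebesgue_measure]_(y in `[x0, x0 + s / 2]) fejerR N ((y - x0) / s)
  = s / 2.
Proof.
move=> s0; rewrite integral_fejerR ?ltrDl ?divr_gt0//.
rewrite (_ : (x0 + s / 2 - x0) / s = 2^-1); last by field; rewrite gt_eqF.
by rewrite subrr mul0r fejer_primitive0 subr0 fejer_primitive_half.
Qed.

Lemma integral_fejerR_left N (x0 s : R) : 0 < s ->
  \int[lebesgue_measure]_(y in `[x0 - s / 2, x0]) fejerR N ((y - x0) / s)
  = s / 2.
Proof.
move=> s0; rewrite integral_fejerR ?gtrBl ?divr_gt0//.
rewrite (_ : (x0 - s / 2 - x0) / s = - 2^-1); last by field; rewrite gt_eqF.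
by rewrite subrr mul0r fejer_primitive0 sub0r fejer_primitiveN opprK fejer_primitive_half.
Qed.

End FejerKernel.

(** * Approximate identities *)

Section ApproximateIdentity.
Context d (T : measurableType d) {R : realType}.
Variable mu : {measure set T -> \bar R}.

(** Kernels of mass c that concentrate where p is close to l. The sets U and
    the bounds M N stand for shrinking neighbourhoods of the concentration point,
    which lets the lemma apply to one side of a point. On D,
    |p - l| k_N <= e k_N + |M_N| |p - l|
    holds both on U and off U, and integrating it needs no splitting of D. *)
Lemma approximate_identity (D : set T) (p : T -> R) (k : nat -> T -> R)
    (l c : R) :
  measurable D -> (mu D < +oo)%E ->
  mu.-integrable D (EFin \o p) ->
  (forall N, measurable_fun D (k N)) ->
  (forall N, [bounded k N x | x in D]) ->
  (forall N x, D x -> 0 <= k N x) ->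
  (forall N, \int[mu]_(x in D) k N x = c) ->
  (forall e : R, 0 < e -> exists U : set T,
    (forall x, D x -> U x -> `|p x - l| <= e) /\
    (exists2 M : nat -> R, M N @[N --> \oo] --> 0 &
       forall N x, D x -> ~ U x -> k N x <= M N)) ->
  (\int[mu]_(x in D) (p x * k N x)) @[N --> \oo] --> c * l.
Proof.
move=> mD Dfin ip mk bk k0 kc conc.
have ik N : mu.-integrable D (EFin \o k N).
  exact: measurable_bounded_integrable.
have il : mu.-integrable D (EFin \o (fun x => p x - l)).
  apply: (@integrableB _ _ _ mu D mD (EFin \o p) (cst l%:E)) => //.
  apply: measurable_bounded_integrable => //.
  exact: bounded_cst.
have ipk N : mu.-integrable D (EFin \o (fun x => (p x - l) * k N x)).
  exact: (@integrableMl _ _ _ mu D mD _ (k N) il (mk N) (bk N)).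
pose I := \int[mu]_(x in D) `|p x - l|.
have I0 : 0 <= I by apply: Rintegral_ge0.
have c0 : 0 <= c by rewrite -(kc 0%N); apply: Rintegral_ge0; exact: k0.
have split N : \int[mu]_(x in D) (p x * k N x) =
    \int[mu]_(x in D) ((p x - l) * k N x) + c * l.
  rewrite -(kc N) mulrC -RintegralZl// -RintegralD//.
    by apply: eq_Rintegral => x _; ring.
  exact: (@integrableZl _ _ _ mu D mD l (EFin \o k N) (ik N)).
apply/cvgrPdist_lt => e e0.
(* Adding 1 to the denominator allows c = 0. *)
have [w w0 wc] : exists2 w, 0 < w & w * c <= e / 2.
  exists (e / 2 / (c + 1)); first by rewrite !divr_gt0// ltr_wpDl.
  rewrite mulrAC ler_pdivrMr ?ltr_wpDl// ler_wpM2l ?lerDl//.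
  by rewrite ltW// divr_gt0.
have [U [pU [M M0 kM]]] := conc _ w0.
have key N : `|c * l - \int[mu]_(x in D) (p x * k N x)| <=
    w * c + `|M N| * I.
  rewrite split opprD addrCA subrr addr0 normrN.
  rewrite (le_trans (le_normr_Rintegral _ _))//.
  have ie : mu.-integrable D (EFin \o (fun x => w * k N x)).
    exact: (@integrableZl _ _ _ mu D mD _ (EFin \o k N) (ik N)).
  have ia : mu.-integrable D (EFin \o (fun x => `|p x - l|)).
    exact: (@integrable_abse _ _ _ mu D _ il).
  have iM : mu.-integrable D (EFin \o (fun x => `|M N| * `|p x - l|)).
    exact: (@integrableZl _ _ _ mu D mD _ _ ia).
  rewrite -[in leRHS](kc N) -RintegralZl// -RintegralZl// -RintegralD//.
  apply: le_Rintegral => //.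
  - exact: (@integrable_abse _ _ _ mu D _ (ipk N)).
  - exact: (@integrableD _ _ _ mu D mD _ _ ie iM).
  move=> x Dx; rewrite normrM (ger0_norm (k0 _ _ Dx)).
  have [Ux|nUx] := pselect (U x).
    by rewrite ler_wpDr ?mulr_ge0// ler_wpM2r ?k0// pU.
  rewrite ler_wpDl ?mulr_ge0 ?k0 ?(ltW w0)// mulrC ler_wpM2r//.
  by rewrite (le_trans (kM _ _ Dx nUx))// ler_norm.
have : \forall N \near \oo, `|M N| < e / 2 / (I + 1).
  have eI : 0 < e / 2 / (I + 1) by rewrite !divr_gt0// ltr_wpDl.
  move/cvgrPdist_lt : M0 => /(_ _ eI); apply: filterS => N.
  by rewrite sub0r normrN.
apply: filterS => N MN; rewrite (le_lt_trans (key N))//.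
rewrite (splitr e) ler_ltD//.
have := MN; rewrite ltr_pdivlMr ?ltr_wpDl//; apply: le_lt_trans.
by rewrite ler_wpM2l// lerDl.
Qed.

End ApproximateIdentity.

(** * Translation and periodicity *)

Lemma integrable_setU d (T : measurableType d) (R : realType)
    (mu : {measure set T -> \bar R}) (A B : set T) (f : T -> \bar R) :
  measurable A -> measurable B -> [disjoint A & B] ->
  mu.-integrable A f -> mu.-integrable B f -> mu.-integrable (A `|` B) f.
Proof.
move=> mA mB AB /integrableP[mfA fA] /integrableP[mfB fB].
have mf : measurable_fun (A `|` B) f by apply/measurable_funU.
apply/integrableP; split => //.
rewrite ge0_integral_setU//; first exact: lte_add_pinfty.
exact: measurableT_comp.
Qed.

Section Translation.
Context {R : realType}.
Notation mu := (@lebesgue_measure R).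
Implicit Types (A : set R) (f : R -> R).

Let shiftR (c : R) (x : measurableTypeR R) : measurableTypeR R := (x : R) + c.

Let measurable_shiftR c : measurable_fun [set: measurableTypeR R] (shiftR c).
Proof. exact: measurable_funD. Qed.

Lemma lebesgue_measure_shift (c : R) A : measurable A ->
  pushforward mu (shiftR c) A = mu A.
Proof.
move=> mA; apply/esym.
apply: (@lebesgue_measure_unique _ (pushforward mu (shiftR c))) => //.
move=> _ [[a b]] _ <- /=.
rewrite /pushforward (_ : shiftR c @^-1` `]a, b]%classic =
    `]a - c, b - c]%classic); last first.
  by apply/seteqP; split => x /=; rewrite !in_itv/= ltrBlDr lerBrDr.
rewrite !lebesgue_measure_itv/= !lte_fin ltrD2r.
by case: ifP => // _; rewrite -!EFinB; congr (_%:E); lra.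
Qed.

(** Integrability is only known, and only assumed, for the translate of f. The
    measurability of f on A is recovered by translating back. *)
Lemma Rintegral_shift (c : R) A f : measurable A ->
  mu.-integrable ((fun x => x + c) @^-1` A) (EFin \o (fun x => f (x + c))) ->
  mu.-integrable A (EFin \o f) /\
  \int[mu]_(x in A) f x = \int[mu]_(x in (fun x => x + c) @^-1` A) f (x + c).
Proof.
move=> mA; set B := _ @^-1` A => ifc.
have mB : measurable B.
  by rewrite -[B]setTI; exact: measurable_shiftR.
(* The change of variables wants a function measurable on the whole line. *)
pose F : R -> \bar R := (EFin \o f) \_ A.
have FB : {in B, (EFin \o (fun x => f (x + c))) =1 F \o shiftR c}.
  by move=> x; rewrite inE => Bx; rewrite /F /= patchE mem_set.
have iFB : mu.-integrable (shiftR c @^-1` A) (F \o shiftR c).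
  exact: (@eq_integrable _ _ _ mu B mB _ _ FB ifc).
have mF : measurable_fun [set: measurableTypeR R] F.
  have -> : F = ((EFin \o (fun x => f (x + c))) \_ B) \o shiftR (- c).
    apply/funext => x; rewrite /F /shiftR /= !patchE.
    have -> : (x - c \in B) = (x \in A).
      have Bx : B (x - c) = A x by rewrite /B /preimage/= subrK.
      by apply/idP/idP => /set_mem; rewrite ?Bx => Ax; apply/mem_set; rewrite ?Bx.
    by rewrite /= subrK.
  apply: measurableT_comp; last exact: measurable_shiftR.
  apply/(measurable_restrictT _ mB).
  by case/integrableP : ifc.
have FA : {in A, F =1 EFin \o f}.
  by move=> x xA; rewrite /F patchE xA.
have intFA : mu.-integrable A F.
  have /integrableP[_ Foo] := integrable_pushforward (measurable_shiftR c) mF iFB mA.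
  apply/integrableP; split; first exact: measurable_funTS.
  rewrite (eq_measure_integral (pushforward mu (shiftR c)))// => S mS _.
  exact/esym/lebesgue_measure_shift.
split; first exact: (@eq_integrable _ _ _ mu A mA _ _ FA intFA).
rewrite /Rintegral; congr fine.
transitivity (\int[mu]_(x in A) F x)%E.
  by apply: eq_integral => x xA; rewrite FA.
transitivity (\int[pushforward mu (shiftR c)]_(x in A) F x)%E.
  apply: eq_measure_integral => S mS _.
  exact/esym/lebesgue_measure_shift.
rewrite (integral_pushforward (measurable_shiftR c) mF iFB mA).
by apply: eq_integral => x xB; rewrite -FB.
Qed.

Lemma periodicz f (s : R) (k : int) : periodic f s -> periodic f (s *~ k).
Proof.
move=> fs x; case: k => n; first exact: periodicn.
by rewrite NegzE mulrNz -(periodicn fs n.+1 (x - _)) subrK.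
Qed.

(** For 0 <= c <= s, sliding the period by c replaces the piece ]a, a + c] by
    its translate by s, on which f takes the same values. A general b differs
    from such an a + c by a multiple of the period. *)
Lemma periodic_Rintegral f (s a b : R) : 0 < s -> periodic f s ->
  mu.-integrable `]a, a + s] (EFin \o f) ->
  mu.-integrable `]b, b + s] (EFin \o f) /\
  \int[mu]_(x in `]b, b + s]) f x = \int[mu]_(x in `]a, a + s]) f x.
Proof.
move=> s0 fs ia.
have shift_itv (u v t : R) :
    (fun x => x + t) @^-1` `]u + t, v + t]%classic = `]u, v]%classic.
  by apply/seteqP; split => x /=; rewrite !in_itv/= ltrD2r lerD2r.
have frac (c : R) : 0 <= c <= s ->
    mu.-integrable `]a + c, a + c + s] (EFin \o f) /\
    \int[mu]_(x in `]a + c, a + c + s]) f x = \int[mu]_(x in `]a, a + s]) f x.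
  move=> /andP[c0 cs].
  have ac : a <= a + c by rewrite lerDl.
  have acs : a + c <= a + s by rewrite lerD2l.
  have sacs : a + s <= a + c + s by rewrite lerD2r.
  have split1 : `]a, a + s]%classic = `]a, a + c] `|` `]a + c, a + s].
    by rewrite -itv_bndbnd_setU// bnd_simp.
  have split2 : `]a + c, a + c + s]%classic = `]a + c, a + s] `|` `]a + s, a + c + s].
    by rewrite -itv_bndbnd_setU// bnd_simp.
  have disj (u v w : R) : [disjoint `]u, v]%classic & `]v, w]%classic].
    apply/disj_setPS => y [/=]; rewrite !in_itv/= => /andP[_ yv] /andP[].
    by rewrite ltNge yv.
  have i1 : mu.-integrable `]a, a + c] (EFin \o f).
    by apply: integrableS ia => //; rewrite split1; left.
  have i2 : mu.-integrable `]a + c, a + s] (EFin \o f).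
    by apply: integrableS ia => //; rewrite split1; right.
  have [i3 e3] : mu.-integrable `]a + s, a + c + s] (EFin \o f) /\
      \int[mu]_(x in `]a + s, a + c + s]) f x = \int[mu]_(x in `]a, a + c]) f x.
    have fE : (fun x => f (x + s)) = f by apply/funext => x; exact: fs.
    have := @Rintegral_shift s `]a + s, a + c + s]%classic f.
    by rewrite shift_itv fE; apply.
  have i23 : mu.-integrable `]a + c, a + c + s] (EFin \o f).
    by rewrite split2; apply: integrable_setU.
  split => //.
  rewrite split2 Rintegral_setU// -?split2// e3 addrC.
  by rewrite split1 Rintegral_setU// -?split1.
have [k kb] : exists k : int, 0 <= b + s *~ k - a <= s.
  exists (- Num.floor ((b - a) / s)).
  have := real_floor_le (num_real ((b - a) / s)).
  have := real_floorD1_gt (num_real ((b - a) / s)).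
  rewrite ltr_pdivrMr// ler_pdivlMr// mulrNz intrD -(mulrzr s).
  lra.
have [ic ec] := frac _ kb.
have fkE : (fun x => f (x - s *~ k)) = f.
  by apply/funext => x; rewrite -(periodicz f s k fs (x - _)) subrK.
have preE : (fun x => x - s *~ k) @^-1` `]b, b + s]%classic =
    `]a + (b + s *~ k - a), a + (b + s *~ k - a) + s]%classic.
  apply/seteqP; split => x /=; rewrite !in_itv/= => /andP[bx xb];
    by apply/andP; split; lra.
have := @Rintegral_shift (- (s *~ k)) `]b, b + s]%classic f.
by rewrite preE fkE ec; apply.
Qed.

End Translation.

(** * Fejer means of a periodic function at a jump *)

Section FejerMeans.
Context {R : realType}.
Notation mu := (@lebesgue_measure R).
Implicit Types (D : set R) (p : R -> R) (s x : R) (N : nat).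

Lemma fejerR_periodic N : periodic (@fejerR R N) 1.
Proof.
move=> t; congr (_ + _); apply: eq_bigr => j _; congr (_ * (_ *+ 2)).
rewrite mulrDr mulr1 (_ : 2 * pi * j.+1%:R = (pi *+ 2) *+ j.+1).
  by rewrite (periodicn (@cosD2pi R)).
by rewrite mulr_natr mulr_natl.
Qed.

Lemma fejer_kernel_periodic N s (x0 : R) : s != 0 ->
  periodic (fun y => fejerR N ((y - x0) / s)) s.
Proof.
move=> s0 y; rewrite -[RHS]fejerR_periodic; congr fejerR.
by field.
Qed.

Lemma measurable_fejer_kernel N s (x0 : R) D :
  measurable_fun D (fun y => fejerR N ((y - x0) / s)).
Proof.
apply: measurable_funTS; apply: continuous_measurable_fun => y.
apply: (@continuous_comp _ _ _ (fun z => (z - x0) / s) (fejerR N)).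
  by apply: differentiable_continuous; apply/derivable1_diffP.
exact: continuous_fejerR.
Qed.

Lemma bounded_fejer_kernel N s (x0 : R) D :
  [bounded fejerR N ((y - x0) / s) | y in D].
Proof.
have [M leM] := @fejerR_bounded R N; exists M; split; first exact: num_real.
by move=> z Mz y _ /=; rewrite (le_trans (leM _))// ltW.
Qed.

Lemma integrable_fejer_mean N s (x0 : R) D p : measurable D ->
  mu.-integrable D (EFin \o p) ->
  mu.-integrable D (EFin \o (fun y => p y * fejerR N ((y - x0) / s))).
Proof.
move=> mD ip; apply: (@integrableMl _ _ _ mu D mD _ _ ip).
  exact: measurable_fejer_kernel.
exact: bounded_fejer_kernel.
Qed.

(** One side at a time: D will be one of the two half-periods next to x0, with x0
    removed, since nothing is known of p at x0 itself. *)
Lemma fejer_mean_within D p s (x0 l c : R) : 0 < s ->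
  measurable D -> D `<=` `[x0 - s / 2, x0 + s / 2] ->
  mu.-integrable D (EFin \o p) ->
  (forall N, \int[mu]_(y in D) fejerR N ((y - x0) / s) = c) ->
  p y @[y --> within D (nbhs x0)] --> l ->
  \int[mu]_(y in D) (p y * fejerR N ((y - x0) / s)) @[N --> \oo] --> c * l.
Proof.
move=> s0 mD Dx0 ip kc pl.
apply: (@approximate_identity _ _ R mu) => //.
- apply: (@le_lt_trans _ _ (mu `[x0 - s / 2, x0 + s / 2]%classic)).
    by apply: le_measure; rewrite ?inE.
  by rewrite lebesgue_measure_itv/=; case: ifP => _; rewrite -?EFinB ltry.
- by move=> N; exact: measurable_fejer_kernel.
- by move=> N; exact: bounded_fejer_kernel.
- by move=> N x _; exact: fejerR_ge0.
move=> e e0.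
have /cvgrPdist_le/(_ e e0) := pl; rewrite near_withinE.
move=> /nbhs_ballP[del /= del0 H].
exists (ball x0 del); split.
  by move=> x Dx /H/(_ Dx); rewrite distrC.
exists (fun N => (sin (pi * (del / s)) ^+ 2)^-1 * harmonic N).
  rewrite -[X in _ --> X](mulr0 (sin (pi * (del / s)) ^+ 2)^-1).
  by apply: cvgM; [exact: cvg_cst|exact: cvg_harmonic].
move=> N x Dx xfar.
apply: fejerR_le; first exact: divr_gt0.
have := Dx0 _ Dx; rewrite /= in_itv/= => /andP[xl xr].
have {}xfar : del <= `|x - x0|.
  by rewrite leNgt; apply/negP => h; apply: xfar; rewrite /ball/= distrC.
rewrite normrM normfV (gtr0_norm s0) ler_pM2r ?invr_gt0// xfar/=.
rewrite ler_pdivrMr// ler_norml; apply/andP; split; lra.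
Qed.

Lemma fejer_mean_cvg p s (x0 a pl pr : R) : 0 < s -> periodic p s ->
  mu.-integrable `]a, a + s] (EFin \o p) ->
  p x @[x --> x0^'-] --> pl -> p x @[x --> x0^'+] --> pr ->
  \int[mu]_(y in `]a, a + s]) (p y * fejerR N ((y - x0) / s)) @[N --> \oo]
    --> s / 2 * (pl + pr).
Proof.
move=> s0 ps ip hl hr.
have x0l : x0 - s / 2 < x0 by rewrite gtrBl divr_gt0.
have x0r : x0 < x0 + s / 2 by rewrite ltrDl divr_gt0.
have kint u v N : mu.-integrable `[u, v]
    (EFin \o (fun y => fejerR N ((y - x0) / s))).
  apply: measurable_bounded_integrable => //.
  - by rewrite /= lebesgue_measure_itv/=; case: ifP => _; rewrite -?EFinB ltry.
  - exact: measurable_fejer_kernel.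
  - exact: bounded_fejer_kernel.
have pkper N : periodic (fun y => p y * fejerR N ((y - x0) / s)) s.
  by move=> y; rewrite ps fejer_kernel_periodic// gt_eqF.
have x0s : x0 - s / 2 + s = x0 + s / 2 by lra.
have [ip0 _] := periodic_Rintegral p s a (x0 - s / 2) s0 ps ip.
rewrite x0s in ip0.
have ipl : mu.-integrable `]x0 - s / 2, x0] (EFin \o p).
  apply: integrableS ip0 => //; apply: subset_itvl; by rewrite bnd_simp ltW.
have ipr : mu.-integrable `]x0, x0 + s / 2] (EFin \o p).
  apply: integrableS ip0 => //; apply: subset_itvr; by rewrite bnd_simp ltW.
have splitE N : \int[mu]_(y in `]a, a + s]) (p y * fejerR N ((y - x0) / s)) =
    \int[mu]_(y in `]x0 - s / 2, x0[) (p y * fejerR N ((y - x0) / s)) +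
    \int[mu]_(y in `]x0, x0 + s / 2]) (p y * fejerR N ((y - x0) / s)).
  have ik D := @integrable_fejer_mean N s x0 D p.
  have [_ <-] := periodic_Rintegral _ s a (x0 - s / 2) s0 (pkper N)
    (ik _ (measurable_itv _) ip).
  rewrite x0s Rintegral_itv_bndo_bndc; last first.
    apply: ik => //; apply: integrableS ipl => //.
    by apply: subset_itv; rewrite bnd_simp.
  rewrite -(@Rintegral_itvB _ _ (BRight (x0 - s / 2)) (BRight (x0 + s / 2)) x0).
  - by rewrite [RHS]addrC subrK.
  - exact: ik.
  - by rewrite bnd_simp ltW.
  - by rewrite bnd_simp ltW.
rewrite mulrDr; under eq_fun do rewrite splitE.
apply: cvgD.
- apply: fejer_mean_within => //.
  + by move=> x /=; rewrite !in_itv/= => /andP[? ?]; apply/andP; split; lra.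
  + apply: integrableS ipl => //; by apply: subset_itv; rewrite bnd_simp.
  + move=> N; rewrite -[RHS](integral_fejerR_left N x0 s s0).
    rewrite Rintegral_itv_obnd_cbnd ?Rintegral_itv_bndo_bndc//.
    * by apply: integrableS (kint (x0 - s / 2) x0 N) => //;
        apply: subset_itv; rewrite bnd_simp.
    * by apply: integrableS (kint (x0 - s / 2) x0 N) => //;
        apply: subset_itv; rewrite bnd_simp.
  + apply: cvg_trans hl; apply: cvg_app.
    by apply: within_subset => x /=; rewrite in_itv/= => /andP[].
- apply: fejer_mean_within => //.
  + by move=> x /=; rewrite !in_itv/= => /andP[? ?]; apply/andP; split; lra.
  + move=> N; rewrite -[RHS](integral_fejerR_right N x0 s s0).
    rewrite Rintegral_itv_obnd_cbnd//.
    by apply: integrableS (kint x0 (x0 + s / 2) N) => //;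
        apply: subset_itv; rewrite bnd_simp.
  + apply: cvg_trans hr; apply: cvg_app.
    by apply: within_subset => x /=; rewrite in_itv/= => /andP[].
Qed.

End FejerMeans.

(** * Limits of complex functions *)

Section ComplexLimits.
Context {R : realType} {T : Type} {F : set_system T} {FF : Filter F}.
Implicit Types (h k : T -> R[i]) (a b : R[i]).

Lemma normc_ge_Im a : `|complex.Im a|%:C <= `|a|.
Proof.
by rewrite normc_def lecR -sqrtr_sqr ler_wsqrtr// lerDr sqr_ge0.
Qed.

Lemma normc_le_ReIm a : `|a| <= (`|complex.Re a| + `|complex.Im a|)%:C.
Proof.
rewrite [a in leLHS]complexE (le_trans (ler_normD _ _))// normrM.
rewrite rmorphD /=.
by rewrite !normc_def/= !expr0n expr1n/= add0r sqrtr1 mul1r !addr0 !sqrtr_sqr.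
Qed.

Lemma cvg_Re h a : h @ F --> a -> complex.Re (h x) @[x --> F] --> complex.Re a.
Proof.
move=> /cvgrPdist_lt ha; apply/cvgrPdist_lt => e e0.
have : 0 < e%:C by rewrite ltcR.
move=> /ha; apply: filterS => x hx; rewrite -ltcR; apply: le_lt_trans hx.
by rewrite (le_trans _ (normc_ge_Re _))// lecR; case: (a) (h x) => [? ?] [].
Qed.

Lemma cvg_Im h a : h @ F --> a -> complex.Im (h x) @[x --> F] --> complex.Im a.
Proof.
move=> /cvgrPdist_lt ha; apply/cvgrPdist_lt => e e0.
have : 0 < e%:C by rewrite ltcR.
move=> /ha; apply: filterS => x hx; rewrite -ltcR; apply: le_lt_trans hx.
by rewrite (le_trans _ (normc_ge_Im _))// lecR; case: (a) (h x) => [? ?] [].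
Qed.

Lemma cvg_complex (u v : T -> R) (r t : R) :
  u x @[x --> F] --> r -> v x @[x --> F] --> t ->
  (u x +i* v x)%C @[x --> F] --> (r +i* t)%C.
Proof.
move=> /cvgrPdist_lt ur /cvgrPdist_lt vt; apply/cvgrPdist_lt => e e0.
have /andP[/eqP/= Ime Ree] : (complex.Im e == 0) && (0 < complex.Re e).
  by move: e0; rewrite ltcE.
have {Ime}eE : e = (complex.Re e)%:C by case: (e) Ime => ? ? /= ->.
have e2 : 0 < complex.Re e / 2 by rewrite divr_gt0.
near=> x; rewrite eE (le_lt_trans (normc_le_ReIm _))// ltcR /= (splitr (complex.Re e)).
by rewrite ltrD//; near: x; [exact: ur|exact: vt].
Unshelve. all: by end_near. Qed.

Lemma cvg_complexM h k a b : h @ F --> a -> k @ F --> b ->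
  h x * k x @[x --> F] --> a * b.
Proof.
move=> ha kb.
have hRe := cvg_Re h a ha; have hIm := cvg_Im h a ha.
have kRe := cvg_Re k b kb; have kIm := cvg_Im k b kb.
have -> : (fun x => h x * k x) = fun x =>
    ((complex.Re (h x) * complex.Re (k x) - complex.Im (h x) * complex.Im (k x))
    +i* (complex.Re (h x) * complex.Im (k x) + complex.Im (h x) * complex.Re (k x)))%C.
  by apply/funext => x; case: (h x) (k x) => [? ?] [].
have -> : a * b =
    ((complex.Re a * complex.Re b - complex.Im a * complex.Im b)
    +i* (complex.Re a * complex.Im b + complex.Im a * complex.Re b))%C.
  by case: (a) (b) => [? ?] [].
by apply: cvg_complex; [apply: cvgB|apply: cvgD]; apply: cvgM.
Qed.

End ComplexLimits.

(** * Zeros of the sine and chirps *)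

Section Sin.
Context {R : realType}.

(** Subtracting the multiple of pi given by the integer part of x / pi leaves a
    zero of the sine that is at least 0 and less than pi, hence is 0. *)
Lemma sin_eq0 (x : R) : sin x = 0 -> exists k : int, x = k%:~R * pi.
Proof.
move=> sx0; have pi0 := pi_gt0 R.
pose k := Num.floor (x / pi); exists k.
have skpi : sin (k%:~R * pi) = 0 :> R.
  rewrite mulrC; case: (k) => n; first exact: sin_pi_nat.
  by rewrite NegzE mulrNz mulrN sinN sin_pi_nat oppr0.
have := real_floor_le (num_real (x / pi)); rewrite ler_pdivlMr// -/k => kx.
have := real_floorD1_gt (num_real (x / pi)).
rewrite ltr_pdivrMr// -/k intrD mulrDl mul1r => xk.
apply/eqP; rewrite -subr_eq0; apply/eqP/le_anti; rewrite subr_ge0 kx andbT.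
rewrite leNgt; apply/negP => r0.
have : 0 < sin (x - k%:~R * pi) by rewrite sin_gt0_pi// r0/= ltrBlDl.
by rewrite sinB sx0 skpi mul0r mulr0 subrr ltxx.
Qed.

Lemma chirpNK (alpha x : R) : chirpN alpha x * chirp alpha x = 1.
Proof.
rewrite /chirpN /chirp /cexpi cosN sinN.
apply/eqP; rewrite eq_complex/=; apply/andP; split; apply/eqP.
  by rewrite mulNr opprK -!expr2 cos2Dsin2.
by ring.
Qed.

End Sin.

Section Chirp.
Context {R : realType}.
Implicit Types alpha x : R.

Lemma continuous_chirp alpha x : chirp alpha y @[y --> x] --> chirp alpha x.
Proof.
have cc : {for x, continuous (fun y : R => pi * y ^+ 2 * cot alpha)}.
  by apply: differentiable_continuous; apply/derivable1_diffP.
apply: cvg_complex.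
  exact: (continuous_comp cc (@continuous_cos R _)).
exact: (continuous_comp cc (@continuous_sin R _)).
Qed.

(** The relation f = e_{-alpha} g is only available on the fundamental interval,
    while a one-sided neighbourhood of an end of that interval may lie outside.
    A translation by u, which is 0 or a period up to sign, brings it back inside;
    the condition on u holds because u moves one end to the opposite one and the
    chirp is even. *)
Lemma cvg_dechirp alpha (f g : R -> R[i]) (F : set_system R) {FF : Filter F}
    (x0 u : R) (l : R[i]) :
  (forall x, torus alpha x -> f x = chirpN alpha x * g x) ->
  F `=>` nbhs x0 -> (\forall y \near F, torus alpha (y + u)) ->
  (x0 + u) ^+ 2 = x0 ^+ 2 ->
  (forall y, f (y + u) = f y) -> (forall y, g (y + u) = g y) ->
  f @ F --> l -> g @ F --> chirp alpha x0 * l.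
Proof.
move=> fg Fx0 tu x0u fu gu fl.
have -> : chirp alpha x0 = chirp alpha (x0 + u) by rewrite /chirp x0u.
have cu : chirp alpha (y + u) @[y --> F] --> chirp alpha (x0 + u).
  apply: (@cvg_comp _ _ _ (fun y => y + u) (chirp alpha) _ (nbhs (x0 + u))).
    by apply: cvgD; [exact: Fx0|exact: cvg_cst].
  exact: continuous_chirp.
apply: cvg_trans (cvg_complexM _ _ _ _ cu fl).
apply: near_eq_cvg; apply: filterS tu => y /fg fgy.
by rewrite -fu fgy mulrA [chirp _ _ * _]mulrC chirpNK mul1r gu.
Qed.

End Chirp.

(** * Reduction of the fractional convolution *)

Section FracConv.
Context {R : realType}.
Notation mu := (@lebesgue_measure R).

Lemma csc_fejerR (alpha x y : R) N : fejerR N ((x - y) * csc alpha) =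
  fejerR N ((y - x) / `|sin alpha|).
Proof.
rewrite /csc; have [s0|s0] := leP 0 (sin alpha).
  by rewrite ger0_norm// -fejerRN -mulNr opprB.
by rewrite ltr0_norm// invrN mulrN -mulNr opprB.
Qed.

Lemma frac_conv_fejer (alpha x0 : R) (f g : R -> R[i]) N :
  (forall x, torus alpha x -> f x = chirpN alpha x * g x) ->
  cintegrable (torus alpha) g ->
  let s := `|sin alpha| in
  frac_conv alpha f (fejer N) x0 = (s^-1)%:C * chirpN alpha x0 *
    ((\int[mu]_(y in `]- (s / 2), - (s / 2) + s])
        (complex.Re (g y) * fejerR N ((y - x0) / s))) +i*
     (\int[mu]_(y in `]- (s / 2), - (s / 2) + s])
        (complex.Im (g y) * fejerR N ((y - x0) / s))))%C.
Proof.
move=> fg [iRe iIm] s; rewrite /torus -/s in iRe iIm.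
rewrite /frac_conv /csc normfV -/(csc alpha) -/s; congr (_ * _).
rewrite /cintegral.
have fE y : torus alpha y -> chirp alpha y * f y * fejer N ((x0 - y) * csc alpha)
    = g y * (fejerR N ((y - x0) / s))%:C.
  move=> ty; rewrite fejerE csc_fejerR fg// mulrA [chirp _ _ * _]mulrC.
  by rewrite chirpNK mul1r.
have sE : - (s / 2) + s = s / 2 by lra.
rewrite sE !Rintegral_itv_obnd_cbnd.
- congr Complex; apply: eq_Rintegral => y /set_mem ty; rewrite fE//.
    by case: (g y) => a b /=; rewrite mulr0 subr0.
  by case: (g y) => a b /=; rewrite mulr0 add0r.
- apply: integrable_fejer_mean => //; apply: integrableS iIm => //.
  by apply: subset_itvr; rewrite bnd_simp.
- apply: integrable_fejer_mean => //; apply: integrableS iRe => //.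
  by apply: subset_itvr; rewrite bnd_simp.
Qed.

(** At the left end of the interval the points on the left of x0 are translated by
    one period to reach the other end. *)
Lemma cvg_left_dechirp (alpha x0 : R) (f g : R -> R[i]) (l : R[i]) :
  sin alpha != 0 ->
  periodic f `|sin alpha| -> periodic g `|sin alpha| ->
  (forall x, torus alpha x -> f x = chirpN alpha x * g x) ->
  torus alpha x0 ->
  f x @[x --> x0^'-] --> l -> g x @[x --> x0^'-] --> chirp alpha x0 * l.
Proof.
move=> sin0 fs gs fg; set s := `|sin alpha| in fs gs *.
have s0 : 0 < s by rewrite normr_gt0.
rewrite {1}/torus /= in_itv/= -/s => /andP[x0l x0r].
have sub : x0^'- `=>` nbhs x0 by exact: cvg_within.
move: x0l; rewrite le_eqVlt => /predU1P[x0E|x0l].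
- apply: (cvg_dechirp alpha f g _ x0 s) => //.
    near=> y; rewrite /torus/= in_itv/= -/s.
    have yx0 : y < x0 by near: y; exact: nbhs_left_lt.
    have : x0 - s < y by near: y; apply: nbhs_left_gt; lra.
    by move=> ?; apply/andP; split; lra.
  by rewrite -x0E; field.
apply: (cvg_dechirp alpha f g _ x0 0) => //; first last.
- by move=> y; rewrite addr0.
- by move=> y; rewrite addr0.
- by rewrite addr0.
near=> y; rewrite /torus/= in_itv/= -/s addr0.
have yx0 : y < x0 by near: y; exact: nbhs_left_lt.
have : - (s / 2) < y by near: y; exact: nbhs_left_gt.
by move=> ?; apply/andP; split; lra.
Unshelve. all: by end_near. Qed.

(** The mirror image of [cvg_left_dechirp], with the exception at the right end. *)
Lemma cvg_right_dechirp (alpha x0 : R) (f g : R -> R[i]) (l : R[i]) :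
  sin alpha != 0 ->
  periodic f `|sin alpha| -> periodic g `|sin alpha| ->
  (forall x, torus alpha x -> f x = chirpN alpha x * g x) ->
  torus alpha x0 ->
  f x @[x --> x0^'+] --> l -> g x @[x --> x0^'+] --> chirp alpha x0 * l.
Proof.
move=> sin0 fs gs fg; set s := `|sin alpha| in fs gs *.
have s0 : 0 < s by rewrite normr_gt0.
rewrite {1}/torus /= in_itv/= -/s => /andP[x0l x0r].
have sub : x0^'+ `=>` nbhs x0 by exact: cvg_within.
move: x0r; rewrite le_eqVlt => /predU1P[x0E|x0r].
- apply: (cvg_dechirp alpha f g _ x0 (- s)) => //.
  + near=> y; rewrite /torus/= in_itv/= -/s.
    have yx0 : x0 < y by near: y; exact: nbhs_right_gt.
    have : y < x0 + s by near: y; apply: nbhs_right_lt; lra.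
    by move=> ?; apply/andP; split; lra.
  + by rewrite x0E; field.
  + by move=> y; rewrite -fs subrK.
  + by move=> y; rewrite -gs subrK.
apply: (cvg_dechirp alpha f g _ x0 0) => //; first last.
- by move=> y; rewrite addr0.
- by move=> y; rewrite addr0.
- by rewrite addr0.
near=> y; rewrite /torus/= in_itv/= -/s addr0.
have yx0 : x0 < y by near: y; exact: nbhs_right_gt.
have : y < s / 2 by near: y; exact: nbhs_right_lt.
by move=> ?; apply/andP; split; lra.
Unshelve. all: by end_near. Qed.

End FracConv.

Theorem theorem5p1 (R : realType) (alpha : R)
  (halpha : forall k : int, alpha != k%:~R * pi)
  (f : R -> R[i]) (hf : chirpN_L1_torus alpha f)
  (x0 : R) (hx0 : torus alpha x0)
  (fl fr : R[i])
  (hfl : f x @[x --> x0^'-] --> fl)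
  (hfr : f x @[x --> x0^'+] --> fr) :
  frac_conv alpha f (fejer N) x0 @[N --> \oo] --> 2^-1 * (fr + fl).
Proof.
have sin0 : sin alpha != 0.
  by apply/eqP => /sin_eq0[k]; apply/eqP/halpha.
case: hf => fs [g [gs ig] fg].
have gl := cvg_left_dechirp alpha x0 f g fl sin0 fs gs fg hx0 hfl.
have gr := cvg_right_dechirp alpha x0 f g fr sin0 fs gs fg hx0 hfr.
under eq_fun do rewrite (frac_conv_fejer alpha x0 f g _ fg ig).
set s := `|sin alpha|.
have s0 : 0 < s by rewrite normr_gt0.
have sE : - (s / 2) + s = s / 2 by lra.
set a := chirp alpha x0 * fl in gl; set b := chirp alpha x0 * fr in gr.
have -> : 2^-1 * (fr + fl) = (s^-1)%:C * chirpN alpha x0 *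
    ((s / 2 * (complex.Re a + complex.Re b)) +i*
     (s / 2 * (complex.Im a + complex.Im b)))%C.
  have -> : ((s / 2 * (complex.Re a + complex.Re b)) +i*
     (s / 2 * (complex.Im a + complex.Im b)))%C = (s / 2)%:C * (a + b).
    by case: (a) (b) => [? ?] [? ?];
      apply/eqP; rewrite eq_complex/= !mul0r subr0 addr0 !eqxx.
  rewrite /a /b -mulrDr mulrACA -rmorphM/=.
  have -> : s^-1 * (s / 2) = 2^-1 by field; rewrite gt_eqF.
  rewrite fmorphV rmorph_nat [chirpN _ _ * _]mulrA chirpNK mul1r.
  by rewrite [fl + fr]addrC.
have [iRe iIm] := ig.
have itorus (p : R -> R) : lebesgue_measure.-integrable (torus alpha) (EFin \o p) ->
    lebesgue_measure.-integrable `]- (s / 2), - (s / 2) + s] (EFin \o p).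
  rewrite /torus -/s sE => ip; apply: integrableS ip => //.
  by apply: subset_itvr; rewrite bnd_simp.
apply: cvg_complexM; first exact: cvg_cst.
apply: cvg_complex; apply: fejer_mean_cvg => //.
- by move=> y; rewrite gs.
- exact: itorus.
- exact: (cvg_Re _ _ gl).
- exact: (cvg_Re _ _ gr).
- by move=> y; rewrite gs.
- exact: itorus.
- exact: (cvg_Im _ _ gl).
- exact: (cvg_Im _ _ gr).
Qed.
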